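(* Let $p\in[1,\infty]$ and let $(\rho_{st})_{0\le s\le t\le T}$ be a fully-dynamic convex risk measure on $(L_p(\mathcal F_t))_t$ which is normalised, i.e. $\rho_{st}(0)=0$ for all $s\le t$. Then $(\rho_{st})_{s,t}$ is strong time-consistent if and only if it is time-consistent and satisfies the restriction property: for all $0\le r\le s\le t\le T$, $$\rho_{rt}(Y)=\rho_{rs}(Y),\qquad Y\in L_p(\mathcal F_s).$$
   Context: Let $T\in(0,\infty)$ and let $(\Omega,\mathcal F,(\mathcal F_t)_{t\in[0,T]},P)$ be a complete filtered probability space with $\mathcal F_0$ trivial; $L_p(\mathcal F_t)=L_p(\Omega,\mathcal F_t,P)$. Relations between random variables hold $P$-a.s. A fully-dynamic convex risk measure on $(L_p(\mathcal F_t))_t$ is a family of mappings $\rho_{st}:L_p(\mathcal F_t)\to L_p(\mathcal F_s)$, $0\le s\le t\le T$, each of which is: monotone ($\rho_{st}(X')\le\rho_{st}(X'')$ if $X'\ge X''$); convex; $\mathcal F_s$-translation invariant ($\rho_{st}(X+f)=\rho_{st}(X)-f$ for $f\in L_p(\mathcal F_s)$); and, if $p=\infty$, continuous from below ($X_n\uparrow X$ $P$-a.s. in $L_\infty(\mathcal F_t)$ implies $\rho_{st}(X_n)\downarrow\rho_{st}(X)$ $P$-a.s.). Strong time-consistent: for all $r\le s\le t$, $\rho_{rt}(X)=\rho_{rs}(-\rho_{st}(X))$ for all $X\in L_p(\mathcal F_t)$. Time-consistent: for all $r\le s\le t$ and all $X,Y\in L_p(\mathcal F_t)$, $\rho_{st}(X)=\rho_{st}(Y)$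 implies $\rho_{rt}(X)=\rho_{rt}(Y)$. *)

(* Defs.v *)
From HB Require Import structures.
From mathcomp Require Import all_boot all_order all_algebra.
From mathcomp Require Import all_classical all_reals all_analysis.

Set Implicit Arguments.
Unset Strict Implicit.
Unset Printing Implicit Defensive.

Import Order.TTheory GRing.Theory Num.Theory.
Import numFieldNormedType.Exports.

Local Open Scope classical_set_scope.
Local Open Scope ring_scope.

(* Random variables are represented by genuine functions Omega -> R, and every
   relation between them is required P-almost surely.  F is relevant only at
   times 0 <= t <= T; F t is unconstrained elsewhere. *)

Record complete_filtration {R : realType} {d : measure_display}
    {Omega : measurableType d} (P : probability Omega R) (T : R)
    (F : R -> set (set Omega)) : Prop := CompleteFiltration {
  filtration_sigma_algebra :
    forall t : R, 0 <= t <= T -> sigma_algebra setT (F t) ;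
  filtration_measurable :
    forall t : R, 0 <= t <= T -> F t `<=` measurable ;
  filtration_nondecreasing :
    forall s t : R, 0 <= s <= t -> t <= T -> F s `<=` F t ;
  filtration_complete_space : measure_is_complete P ;
  filtration_negligible : forall N, P.-negligible N -> F 0 N }.

Definition trivial_sigma_algebra {R : realType} {d : measure_display}
    {Omega : measurableType d} (P : probability Omega R)
    (G : set (set Omega)) : Prop :=
  forall A, G A -> P A = 0%E \/ P A = 1%E.

(* L_p(Omega, G, P) for a sub-sigma-algebra G. *)
Definition Lp {R : realType} {d : measure_display}
    {Omega : measurableType d} (P : probability Omega R) (p : \bar R)
    (G : set (set Omega)) : set (Omega -> R) :=
  [set X | X \in Lfun P p /\
           forall B : set R, measurable B -> G (X @^-1` B)].

Section RiskMeasure.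
Context {R : realType} {d : measure_display} {Omega : measurableType d}.
Variables (P : probability Omega R) (T : R) (F : R -> set (set Omega)).
Variable p : \bar R.
Implicit Types (rho : R -> R -> (Omega -> R) -> Omega -> R).
Implicit Types (X Y f : Omega -> R).

(* rho s t is a total function, but it is only constrained, and only used, for
   0 <= s <= t <= T and on Lp P p (F t).  Applying monotonicity both ways shows
   that it is compatible with almost sure equality, so that it induces a map
   between spaces of classes. *)
Record fully_dynamic_convex_risk_measure rho : Prop := FDConvexRiskMeasure {
  risk_Lp : forall s t : R, 0 <= s <= t -> t <= T ->
    forall X, Lp P p (F t) X -> Lp P p (F s) (rho s t X) ;
  risk_monotone : forall s t : R, 0 <= s <= t -> t <= T ->
    forall X Y, Lp P p (F t) X -> Lp P p (F t) Y ->
    {ae P, forall w, Y w <= X w} ->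
    {ae P, forall w, rho s t X w <= rho s t Y w} ;
  risk_convex : forall s t : R, 0 <= s <= t -> t <= T ->
    forall X Y (a : R), Lp P p (F t) X -> Lp P p (F t) Y -> 0 <= a <= 1 ->
    {ae P, forall w, rho s t (fun v => a * X v + (1 - a) * Y v) w
                     <= a * rho s t X w + (1 - a) * rho s t Y w} ;
  risk_translation : forall s t : R, 0 <= s <= t -> t <= T ->
    forall X f, Lp P p (F t) X -> Lp P p (F s) f ->
    {ae P, forall w, rho s t (X \+ f) w = rho s t X w - f w} ;
  risk_continuous_below : p = +oo%E ->
    forall s t : R, 0 <= s <= t -> t <= T ->
    forall (Xn : nat -> Omega -> R) X,
    (forall n, Lp P p (F t) (Xn n)) -> Lp P p (F t) X ->
    {ae P, forall w, nondecreasing_seq (fun n => Xn n w) /\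
                     (fun n => Xn n w) @ \oo --> X w} ->
    {ae P, forall w, nonincreasing_seq (fun n => rho s t (Xn n) w) /\
                     (fun n => rho s t (Xn n) w) @ \oo --> rho s t X w} }.

Definition normalised rho : Prop :=
  forall s t : R, 0 <= s <= t -> t <= T ->
  {ae P, forall w, rho s t (fun=> 0) w = 0}.

Definition strong_time_consistent rho : Prop :=
  forall r s t : R, 0 <= r <= s -> s <= t <= T ->
  forall X, Lp P p (F t) X ->
  {ae P, forall w, rho r t X w = rho r s (fun v => - rho s t X v) w}.

Definition time_consistent rho : Prop :=
  forall r s t : R, 0 <= r <= s -> s <= t <= T ->
  forall X Y, Lp P p (F t) X -> Lp P p (F t) Y ->
  {ae P, forall w, rho s t X w = rho s t Y w} ->
  {ae P, forall w, rho r t X w = rho r t Y w}.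

Definition restriction_property rho : Prop :=
  forall r s t : R, 0 <= r <= s -> s <= t <= T ->
  forall Y, Lp P p (F s) Y ->
  {ae P, forall w, rho r t Y w = rho r s Y w}.

End RiskMeasure.

(* Main.v *)
(** Translation invariance and normalisation give [rho s t Y = - Y] for every
    [F s]-measurable [Y].  Under strong time-consistency this turns
    [rho r t Y = rho r s (- rho s t Y)] into the restriction property.
    Conversely, [Y = - rho s t X] satisfies [rho s t Y = rho s t X], so
    time-consistency and restriction give [rho r t X = rho r t Y = rho r s Y]. *)
Require Import Defs.
From HB Require Import structures.
From mathcomp Require Import all_boot all_order all_algebra.
From mathcomp Require Import all_classical all_reals all_analysis.

Set Implicit Arguments.
Unset Strict Implicit.
Unset Printing Implicit Defensive.

Local Open Scope ring_scope.

Import Order.TTheory GRing.Theory Num.Theory.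

Section Lp.
Context {R : realType} {d : measure_display} {Omega : measurableType d}.
Variables (P : probability Omega R) (p : \bar R).

Lemma Lp_subset (G H : set (set Omega)) :
  (G `<=` H -> Lp P p G `<=` Lp P p H)%classic.
Proof. by move=> GH X [XLfun XG]; split=> // B /XG /GH. Qed.

Lemma LpN (G : set (set Omega)) (X : Omega -> R) :
  Lp P p G X -> Lp P p G (fun w => - X w).
Proof.
move=> [XLfun XG]; split; first exact: Lfun_oppr_closed.
(* The preimage of [B] under [- X] is the preimage under [X] of the reflected set, which is again
   Borel. *)
move=> B mB; apply: (XG (-%R @^-1` B)%classic).
by rewrite -[X in measurable X]setTI; exact: measurable_realfun.oppr_measurable.
Qed.

Lemma Lp_cst0 (G : set (set Omega)) :
  (1 <= p)%E -> sigma_algebra setT G -> Lp P p G (fun=> 0).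
Proof.
move=> p1 [G0 GC _]; split; first by have [] := Lfun_addr_closed P p1.
move=> B _; have [B0|B0] := pselect (B 0).
(* The whole space is written as the complement of [set0], the form in which a sigma-algebra on
   [setT] provides it. *)
- suff -> : ((fun=> 0 : R) @^-1` B = setT `\` set0 :> set Omega)%classic.
    exact: GC.
  by rewrite setD0; apply/seteqP; split.
- suff -> : ((fun=> 0 : R) @^-1` B = set0 :> set Omega)%classic by [].
  by apply/seteqP; split.
Qed.

End Lp.

Section RiskMeasure.
Context {R : realType} {d : measure_display} {Omega : measurableType d}.
Variables (P : probability Omega R) (T : R) (F : R -> set (set Omega)).
Variables (p : \bar R) (rho : R -> R -> (Omega -> R) -> Omega -> R).
Hypothesis risk_rho : fully_dynamic_convex_risk_measure P T F p rho.

Lemma risk_ae_eq (s t : R) (X Y : Omega -> R) : 0 <= s <= t -> t <= T ->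
  Lp P p (F t) X -> Lp P p (F t) Y ->
  {ae P, forall w, X w = Y w} -> {ae P, forall w, rho s t X w = rho s t Y w}.
Proof.
move=> st tT LX LY XY.
have YX : {ae P, forall w, Y w <= X w} by apply: filterS XY => w ->.
have XY' : {ae P, forall w, X w <= Y w} by apply: filterS XY => w ->.
have := risk_monotone risk_rho st tT LY LX XY'.
have := risk_monotone risk_rho st tT LX LY YX.
by apply: filterS2 => w XYw YXw; apply/eqP; rewrite eq_le XYw YXw.
Qed.

Hypothesis filtration_F : complete_filtration P T F.
Hypothesis p_ge1 : (1 <= p)%E.
Hypothesis normalised_rho : normalised P T rho.

(** [Y] is the zero position shifted by [Y], so translation invariance reduces the claim to
    normalisation at [0]. *)
Lemma risk_adapted (s t : R) (Y : Omega -> R) : 0 <= s <= t -> t <= T ->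
  Lp P p (F s) Y -> {ae P, forall w, rho s t Y w = - Y w}.
Proof.
move=> st tT LY; have /andP[s0 s_le_t] := st.
have t0T : 0 <= t <= T by rewrite (le_trans s0).
have L0 := Lp_cst0 P p_ge1 (filtration_sigma_algebra filtration_F t0T).
have := risk_translation risk_rho st tT L0 LY.
have -> : ((fun=> 0) \+ Y)%R = Y by apply/funext => w /=; rewrite add0r.
apply: filterS2 (normalised_rho st tT) => w -> ->.
by rewrite sub0r.
Qed.

(** Strong time-consistency makes [rho r t X] depend on [X] only through [rho s t X], up to almost
    sure equality. *)
Lemma strong_time_consistent_time_consistent :
  strong_time_consistent P T F p rho -> time_consistent P T F p rho.
Proof.
move=> strong r s t rs st X Y LX LY XY.
have /andP[r0 r_le_s] := rs; have /andP[s_le_t tT] := st.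
have s0t : 0 <= s <= t by rewrite (le_trans r0).
have LNX := LpN (risk_Lp risk_rho s0t tT LX).
have LNY := LpN (risk_Lp risk_rho s0t tT LY).
have NXY : {ae P, forall w, - rho s t X w = - rho s t Y w}.
  by apply: filterS XY => w ->.
have := risk_ae_eq rs (le_trans s_le_t tT) LNX LNY NXY.
by apply: filterS3 (strong r s t rs st X LX) (strong r s t rs st Y LY) => w -> ->.
Qed.

Lemma strong_time_consistent_restriction :
  strong_time_consistent P T F p rho -> restriction_property P T F p rho.
Proof.
move=> strong r s t rs st Y LY.
have /andP[r0 r_le_s] := rs; have /andP[s_le_t tT] := st.
have s0t : 0 <= s <= t by rewrite (le_trans r0).
(* [Y] is needed at both times: at [t] as an argument of [rho s t], at [s] as an argument of
   [rho r s]. *)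
have LYt := Lp_subset (filtration_nondecreasing filtration_F s0t tT) LY.
have NNY : {ae P, forall w, - rho s t Y w = Y w}.
  by apply: filterS (risk_adapted s0t tT LY) => w ->; rewrite opprK.
have LN := LpN (risk_Lp risk_rho s0t tT LYt).
have := risk_ae_eq rs (le_trans s_le_t tT) LN LY NNY.
by apply: filterS2 (strong r s t rs st Y LYt) => w ->.
Qed.

Lemma time_consistent_restriction_strong :
  time_consistent P T F p rho -> restriction_property P T F p rho ->
  strong_time_consistent P T F p rho.
Proof.
move=> consistent restriction r s t rs st X LX.
have /andP[r0 r_le_s] := rs; have /andP[s_le_t tT] := st.
have s0t : 0 <= s <= t by rewrite (le_trans r0).
have LN := LpN (risk_Lp risk_rho s0t tT LX).
(* Time-consistency compares [X] with [- rho s t X] as positions at time [t], whereas restriction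
   uses the latter at time [s]. *)
have LNt := Lp_subset (filtration_nondecreasing filtration_F s0t tT) LN.
have XN : {ae P, forall w,
    rho s t X w = rho s t (fun v => - rho s t X v) w}.
  (* The two minus signs cancel: [rho s t] negates the adapted position [- rho s t X]. *)
  by apply: filterS (risk_adapted s0t tT LN) => w ->; rewrite opprK.
have := restriction r s t rs st _ LN.
by apply: filterS2 (consistent r s t rs st _ _ LX LNt XN) => w ->.
Qed.

End RiskMeasure.

Theorem corollary2p16 (R : realType) (d : measure_display)
    (Omega : measurableType d) (P : probability Omega R) (T : R)
    (F : R -> set (set Omega)) (p : \bar R)
    (rho : R -> R -> (Omega -> R) -> Omega -> R) :
  0 < T ->
  complete_filtration P T F ->
  trivial_sigma_algebra P (F 0) ->
  (1 <= p)%E ->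
  fully_dynamic_convex_risk_measure P T F p rho ->
  normalised P T rho ->
  strong_time_consistent P T F p rho <->
  (time_consistent P T F p rho /\ restriction_property P T F p rho).
Proof.
move=> _ filtration_F _ p_ge1 risk_rho normalised_rho.
split=> [strong|[consistent restriction]].
  split; first exact: strong_time_consistent_time_consistent risk_rho strong.
  exact: strong_time_consistent_restriction.
exact: time_consistent_restriction_strong.
Qed.
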